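(* Let $n,m,p\ge 1$ be integers, let $E,A\in\mathbb{R}^{n\times n}$, $B\in\mathbb{R}^{n\times m}$, $C_1\in\mathbb{R}^{p\times n}$, $C_2\in\mathbb{R}^{m\times n}$, $R=R^\top\in\mathbb{R}^{m\times m}$, $Z=Z^\top\in\mathbb{R}^{p\times p}$, with $E$ and $R$ invertible (no definiteness of $R$ or $Z$ is assumed), and let $$\hat A=A-BR^{-1}C_2,\qquad \hat C=\begin{bmatrix}C_1\\C_2\end{bmatrix},\qquad \hat Z=\begin{bmatrix}Z&0\\0&-R^{-1}\end{bmatrix}.$$ Let $i\ge 1$ and let $\alpha_1,\dots,\alpha_i\in\mathbb{C}$ be shifts, one per step, with $|\alpha_j|>1$ for all $j$; a non-real $\alpha_j$ represents the conjugate pair $\{\alpha_j,\overline{\alpha_j}\}$, which is processed in the single step $j$. Let $s_r^{(j)}, l_r^{(j)}, x_r^{(j)}, w_r^{(j)}, S_{12}^{(j)}, S_r^{(j)}, L_r^{(j)}, X_r^{(j)}, W_r^{(j)}, \hat C_\perp^{(j)}$ ($1\le j\le i$) be real matrices satisfying the recursive definitions given in the context, so that in particular $W_r^{(i)}$ solves $$\hat A^\top W_r^{(i)}-E^\top W_r^{(i)}S_r^{(i)}+\hat C^\top\hat Z L_r^{(i)}=0.$$ Assume that the pair $(S_r^{(i)},\hat Z L_r^{(i)})$ is observable and that the matrices $X_r^{(i)}$ and $R+(B_r^{(i)})^\top (X_r^{(i)})^{-1}B_r^{(i)}$ are invertible, where $B_r^{(i)}=(W_r^{(i)})^\top B$.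 Assume there exists a real matrix $V_r^{(i)}$ with $(W_r^{(i)})^\top E V_r^{(i)}=I$, and set $$\hat C_r^{(i)}=\begin{bmatrix}C_{1,r}^{(i)}\\C_{2,r}^{(i)}\end{bmatrix}=\hat C V_r^{(i)},\qquad A_r^{(i)}=(W_r^{(i)})^\top A V_r^{(i)},$$ $$\hat A_r^{(i)}=(W_r^{(i)})^\top\hat A V_r^{(i)}=A_r^{(i)}-B_r^{(i)}R^{-1}C_{2,r}^{(i)}=(S_r^{(i)})^\top-(L_r^{(i)})^\top\hat Z\hat C_r^{(i)},$$ where $C_{1,r}^{(i)}$ has $p$ rows and $C_{2,r}^{(i)}$ has $m$ rows. Suppose that (the free parameter) $\hat C_r^{(i)}$ is $$\hat C_r^{(i)}=\begin{bmatrix}\hat c_r^{(1)}&\cdots&\hat c_r^{(i)}\end{bmatrix}=L_r^{(i)}(S_r^{(i)})^{-1}(X_r^{(i)})^{-1},\qquad \hat c_r^{(j)}=\Big(l_r^{(j)}-L_r^{(j-1)}(S_r^{(j-1)})^{-1}S_{12}^{(j)}\Big)(s_r^{(j)})^{-1}(x_r^{(j)})^{-1}.$$ Then the following hold. 1. $Q_r^{(i)}:=(X_r^{(i)})^{-1}$ is a stabilizing solution of the projected discrete-time algebraic Riccati equation $$(\hat A_r^{(i)})^\top Q_r^{(i)}\hat A_r^{(i)}-Q_r^{(i)}-(\hat A_r^{(i)})^\top Q_r^{(i)}B_r^{(i)}\big((B_r^{(i)})^\top Q_r^{(i)}B_r^{(i)}+R\big)^{-1}(B_r^{(i)})^\top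 Q_r^{(i)}\hat A_r^{(i)}+(\hat C_r^{(i)})^\top\hat Z\hat C_r^{(i)}=0,$$ and the closed-loop matrix $$A_{r,cl}^{(i)}=A_r^{(i)}-B_r^{(i)}\big((B_r^{(i)})^\top Q_r^{(i)}B_r^{(i)}+R\big)^{-1}\big((B_r^{(i)})^\top Q_r^{(i)}A_r^{(i)}+C_{2,r}^{(i)}\big)$$ has as eigenvalues the numbers $-1/\alpha_j$ ($1\le j\le i$), together with $-1/\overline{\alpha_j}$ for each $j$ with $\alpha_j$ non-real, each with multiplicity $p+m$ (algebraic multiplicities, added up if shifts are repeated). 2. Let $\hat Q^{(i)}=W_r^{(i)}Q_r^{(i)}(W_r^{(i)})^\top$ and $$R_q^{(i)}=\hat A^\top\hat Q^{(i)}\hat A-E^\top\hat Q^{(i)}E-\hat A^\top\hat Q^{(i)}B\big(B^\top\hat Q^{(i)}B+R\big)^{-1}B^\top\hat Q^{(i)}\hat A+\hat C^\top\hat Z\hat C .$$ Then $(V_r^{(i)})^\top R_q^{(i)}V_r^{(i)}=0$ and $$R_q^{(i)}=(\hat C_\perp^{(i)})^\top\hat Z\,(M^{(i)})^{-1}\hat C_\perp^{(i)},$$ where $M^{(i)}=I_{p+m}-\hat C_r^{(i)}X_r^{(i)}(\hat C_r^{(i)})^\top\hat Z$ (which is invertible), and $M^{(i)}=M^{(i-1)}-\hat c_r^{(i)}x_r^{(i)}(\hat c_r^{(i)})^\top\hat Z$ with $M^{(0)}=I_{p+m}$, where for $1\le j<i$, $M^{(j)}=I_{p+m}-\hat C_r^{(j)}X_r^{(j)}(\hat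 C_r^{(j)})^\top\hat Z$ with $\hat C_r^{(j)}=L_r^{(j)}(S_r^{(j)})^{-1}(X_r^{(j)})^{-1}$. 3. $W_r^{(i)}$ solves the Sylvester equation $$\hat A^\top W_r^{(i)}-E^\top W_r^{(i)}(\hat A_r^{(i)})^\top+(\hat C_\perp^{(i)})^\top\hat Z L_r^{(i)}=0.$$
   Context: Write $q=p+m$ and let $I_q$ be the $q\times q$ identity. All matrices below are real. **Blocks for each shift.** If $\alpha_j$ is real: $s_r^{(j)}=-\alpha_j I_q$ and $l_r^{(j)}=-I_q$. If $\alpha_j$ is not real: $$s_r^{(j)}=\begin{bmatrix}-\mathrm{Re}(\alpha_j)I_q&-\mathrm{Im}(\alpha_j)I_q\\ \mathrm{Im}(\alpha_j)I_q&-\mathrm{Re}(\alpha_j)I_q\end{bmatrix},\qquad l_r^{(j)}=\begin{bmatrix}-I_q&0\end{bmatrix}.$$ Thus $s_r^{(j)}$ is $d_j\times d_j$, with $d_j=q$ if $\alpha_j$ is real and $d_j=2q$ otherwise; $w_r^{(j)}\in\mathbb{R}^{n\times d_j}$ and $x_r^{(j)}\in\mathbb{R}^{d_j\times d_j}$. **Recursion.** For $j=0$ the matrices $S_r^{(0)},L_r^{(0)},X_r^{(0)},W_r^{(0)}$ are empty (all terms containing them are absent) and $\hat C_\perp^{(0)}=\hat C$. For $j=1,\dots,i$: (a) $w_r^{(j)}$ satisfies $$\Big(\hat A^\top-E^\top W_r^{(j-1)}(X_r^{(j-1)})^{-1}(S_r^{(j-1)})^{-\top}(W_r^{(j-1)})^\top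 BR^{-1}B^\top\Big)w_r^{(j)}-E^\top w_r^{(j)}s_r^{(j)}+(\hat C_\perp^{(j-1)})^\top\hat Z l_r^{(j)}=0;$$ (b) $S_{12}^{(j)}=(X_r^{(j-1)})^{-1}(S_r^{(j-1)})^{-\top}\Big((L_r^{(j-1)})^\top\hat Z l_r^{(j)}+(W_r^{(j-1)})^\top BR^{-1}B^\top w_r^{(j)}\Big)$; (c) $x_r^{(j)}$ is the solution of $$(s_r^{(j)})^\top x_r^{(j)}s_r^{(j)}-x_r^{(j)}-(l_r^{(j)})^\top\hat Z l_r^{(j)}-(w_r^{(j)})^\top BR^{-1}B^\top w_r^{(j)}+(S_{12}^{(j)})^\top X_r^{(j-1)}S_{12}^{(j)}=0$$ (unique, because $|\alpha_j|>1$); (d) the accumulated matrices are $$S_r^{(j)}=\begin{bmatrix}S_r^{(j-1)}&S_{12}^{(j)}\\0&s_r^{(j)}\end{bmatrix},\quad L_r^{(j)}=\begin{bmatrix}L_r^{(j-1)}&l_r^{(j)}\end{bmatrix},\quad X_r^{(j)}=\begin{bmatrix}X_r^{(j-1)}&0\\0&x_r^{(j)}\end{bmatrix},\quad W_r^{(j)}=\begin{bmatrix}W_r^{(j-1)}&w_r^{(j)}\end{bmatrix},$$ $$\hat C_\perp^{(j)}=\hat C-L_r^{(j)}(S_r^{(j)})^{-1}(X_r^{(j)})^{-1}(W_r^{(j)})^\top E.$$ Each $S_r^{(j)}$ is invertible since $|\alpha_j|>1$; each $X_r^{(j)}$, $j\le i$, is invertible since $X_r^{(i)}$ is block diagonal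 and assumed invertible. By substitution, $W_r^{(i)}$ and $X_r^{(i)}$ satisfy $$\hat A^\top W_r^{(i)}-E^\top W_r^{(i)}S_r^{(i)}+\hat C^\top\hat Z L_r^{(i)}=0,$$ $$(S_r^{(i)})^\top X_r^{(i)}S_r^{(i)}-X_r^{(i)}-(L_r^{(i)})^\top\hat Z L_r^{(i)}-(W_r^{(i)})^\top BR^{-1}B^\top W_r^{(i)}=0,$$ and $\hat C_\perp^{(i)}=\hat C_\perp^{(i-1)}-\hat c_r^{(i)}(w_r^{(i)})^\top E$, with $\hat c_r^{(i)}$ as in the claim. **Terminology.** A solution $Q_r^{(i)}$ of the projected Riccati equation is called stabilizing if all eigenvalues of the associated closed-loop matrix $A_{r,cl}^{(i)}$ satisfy $|\lambda|<1$. A pair $(S,H)$ is observable if no nonzero (complex) eigenvector of $S$ lies in the kernel of $H$. *)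

(* Defs.v *)
From mathcomp Require Import all_boot all_order all_algebra.
From mathcomp Require Import complex reals.

Set Implicit Arguments.
Unset Strict Implicit.
Unset Printing Implicit Defensive.

Import Order.TTheory GRing.Theory Num.Theory.
Local Open Scope ring_scope.

(* The steps are numbered 1, 2, ... as in the recursion; the values at index 0
   of the families indexed by steps (alpha, w, x below) are never used.
   A quantity accumulated over the steps 1, ..., j is indexed by j, and j = 0
   gives matrices with no columns. *)

Definition toC (K : realType) (m n : nat) (M : 'M[K]_(m, n)) : 'M[K[i]]_(m, n) :=
  map_mx (real_complex K) M.

Definition observable (K : realType) (k r : nat)
    (S : 'M[K]_k) (H : 'M[K]_(r, k)) : Prop :=
  forall (lambda : K[i]) (v : 'cV[K[i]]_k),
    v != 0 -> toC S *m v = lambda *: v -> toC H *m v != 0.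

Definition schur_stable (K : realType) (k : nat) (M : 'M[K]_k) : Prop :=
  forall lambda : K[i], eigenvalue (toC M) lambda -> `|lambda| < 1.

(* s lists the eigenvalues of M, each repeated as often as its algebraic
   multiplicity, i.e. its multiplicity as a root of the characteristic
   polynomial. *)
Definition has_spectrum (K : realType) (k : nat) (M : 'M[K]_k) (s : seq K[i]) :
    Prop :=
  (forall lambda : K[i], eigenvalue (toC M) lambda = (lambda \in s)) /\
  (forall lambda : K[i],
     mup lambda (char_poly (toC M)) = count_mem lambda s).

(* K[i] is the type of complex numbers a +i* b with a, b in K, so that
   complex.Im a == 0 is the test "a is real". *)
Definition shift_dim (K : realType) (q : nat) (a : K[i]) : nat :=
  if complex.Im a == 0 then q else (q + q)%N.

Definition shift_s (K : realType) (q : nat) (a : K[i]) :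
    'M[K]_(shift_dim q a) :=
  if complex.Im a == 0 as b return 'M[K]_(if b then q else (q + q)%N)
  then (- complex.Re a)%:M
  else block_mx (- complex.Re a)%:M (- complex.Im a)%:M
                (complex.Im a)%:M   (- complex.Re a)%:M.

Definition shift_l (K : realType) (q : nat) (a : K[i]) :
    'M[K]_(q, shift_dim q a) :=
  if complex.Im a == 0 as b return 'M[K]_(q, if b then q else (q + q)%N)
  then - 1%:M
  else row_mx (- 1%:M) 0.

(* The numbers -1/alpha_j and, for non-real alpha_j, -1/conj(alpha_j), each
   repeated q times, for j = 1, ..., i. *)
Definition mirrored_shifts (K : realType) (q : nat) (alpha : nat -> K[i])
    (i : nat) : seq K[i] :=
  flatten
    [seq nseq q (- (alpha j)^-1) ++
         (if complex.Im (alpha j) == 0 then [::]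
          else nseq q (- (conjc (alpha j))^-1))
    | j <- iota 1 i].

Section Recursion.

Variables (K : realType) (n m q : nat).
Variables (E : 'M[K]_n) (B : 'M[K]_(n, m)) (R : 'M[K]_m).
Variables (Chat : 'M[K]_(q, n)) (Zhat : 'M[K]_q).
Variable alpha : nat -> K[i].
Variable w : forall j : nat, 'M[K]_(n, shift_dim q (alpha j)).
Variable x : forall j : nat, 'M[K]_(shift_dim q (alpha j)).

Fixpoint acc_dim (j : nat) : nat :=
  if j is j'.+1 then (acc_dim j' + shift_dim q (alpha j'.+1))%N else 0%N.

Fixpoint acc_L (j : nat) : 'M[K]_(q, acc_dim j) :=
  match j with
  | 0%N => 0
  | j'.+1 => row_mx (acc_L j') (shift_l q (alpha j'.+1))
  end.

Fixpoint acc_W (j : nat) : 'M[K]_(n, acc_dim j) :=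
  match j with
  | 0%N => 0
  | j'.+1 => row_mx (acc_W j') (w j'.+1)
  end.

Fixpoint acc_X (j : nat) : 'M[K]_(acc_dim j) :=
  match j with
  | 0%N => 0
  | j'.+1 => block_mx (acc_X j') 0 0 (x j'.+1)
  end.

(* S_{12} of step j, as a function of the matrix S accumulated up to step
   j - 1. *)
Definition S12_from (j : nat) (S : 'M[K]_(acc_dim j.-1)) :
    'M[K]_(acc_dim j.-1, shift_dim q (alpha j)) :=
  invmx (acc_X j.-1) *m (invmx S)^T *m
  ((acc_L j.-1)^T *m Zhat *m shift_l q (alpha j) +
   (acc_W j.-1)^T *m B *m invmx R *m B^T *m w j).

Fixpoint acc_S (j : nat) : 'M[K]_(acc_dim j) :=
  match j with
  | 0%N => 0
  | j'.+1 => block_mx (acc_S j') (@S12_from j'.+1 (acc_S j'))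
                      0          (shift_s q (alpha j'.+1))
  end.

Definition step_S12 (j : nat) : 'M[K]_(acc_dim j.-1, shift_dim q (alpha j)) :=
  S12_from (acc_S j.-1).

Definition acc_C (j : nat) : 'M[K]_(q, acc_dim j) :=
  acc_L j *m invmx (acc_S j) *m invmx (acc_X j).

Definition acc_Cperp (j : nat) : 'M[K]_(q, n) :=
  Chat - acc_C j *m (acc_W j)^T *m E.

Definition step_c (j : nat) : 'M[K]_(q, shift_dim q (alpha j)) :=
  (shift_l q (alpha j) - acc_L j.-1 *m invmx (acc_S j.-1) *m step_S12 j) *m
  invmx (shift_s q (alpha j)) *m invmx (x j).

Fixpoint row_of_steps_c (j : nat) : 'M[K]_(q, acc_dim j) :=
  match j with
  | 0%N => 0
  | j'.+1 => row_mx (row_of_steps_c j') (step_c j'.+1)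
  end.

Definition acc_M (j : nat) : 'M[K]_q :=
  1%:M - acc_C j *m acc_X j *m (acc_C j)^T *m Zhat.

(* Equations (w_eq) and (x_eq) constrain the data w, x of step j >= 1; all the
   other matrices are explicit functions of w and x. *)
Definition w_eq (Ahat : 'M[K]_n) (j : nat) : Prop :=
  (Ahat^T - E^T *m acc_W j.-1 *m invmx (acc_X j.-1) *m (invmx (acc_S j.-1))^T
            *m (acc_W j.-1)^T *m B *m invmx R *m B^T) *m w j
  - E^T *m w j *m shift_s q (alpha j)
  + (acc_Cperp j.-1)^T *m Zhat *m shift_l q (alpha j) = 0.

Definition x_eq (j : nat) : Prop :=
  (shift_s q (alpha j))^T *m x j *m shift_s q (alpha j) - x j
  - (shift_l q (alpha j))^T *m Zhat *m shift_l q (alpha j)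
  - (w j)^T *m B *m invmx R *m B^T *m w j
  + (step_S12 j)^T *m acc_X j.-1 *m step_S12 j = 0.

End Recursion.

(* Main.v *)
Require Import Defs.
From mathcomp Require Import all_boot all_order all_algebra.
From mathcomp Require Import complex reals ring.

Set Implicit Arguments.
Unset Strict Implicit.
Unset Printing Implicit Defensive.

Import Order.TTheory GRing.Theory Num.Theory.
Local Open Scope ring_scope.

(* Write W, S, L, X, C_perp for the matrices accumulated up to step i,
   Q = X^-1 and G = Br R^-1 Br^T.  The recursion is the blockwise form of the
   Sylvester equation for W and of the Stein equation S^T X S - X = L^T Z L + G;
   the blocks x are symmetric because a difference D of two solutions has
   s^T D s = D, while s is |alpha| > 1 times an isometry.

   With C = L S^-1 Q the Stein equation gives Ahat_r = (X + G) S^-1 Q.  By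
   Woodbury, P = Q - Q Br (R + Br^T Q Br)^-1 Br^T Q is the inverse of X + G,
   hence P Ahat_r = S^-1 Q: this yields the Riccati equation, shows that the
   closed-loop matrix is X S^-1 Q, which is similar to S^-1, and gives
   M^-1 = I + L P L^T Z.  In the residual, W^T Ahat = Ahat_r Y - L^T Z C_perp
   and Chat = C_perp + C Y with Y = W^T E; the terms containing Y cancel by the
   projected Riccati equation and what remains is
   C_perp^T (Z + Z L P L^T Z) C_perp. *)

(** * Block triangular inverses and characteristic polynomials *)

Lemma unitmx_ublock (F : fieldType) (n1 n2 : nat)
    (A : 'M[F]_n1) (B : 'M[F]_(n1, n2)) (D : 'M[F]_n2) :
  (block_mx A B 0 D \in unitmx) = (A \in unitmx) && (D \in unitmx).
Proof. by rewrite !unitmxE det_ublock unitrM. Qed.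

Lemma invmx_eq (F : fieldType) (n : nat) (A B : 'M[F]_n) :
  A *m B = 1%:M -> invmx A = B.
Proof.
move=> AB1; have [Au _] := mulmx1_unit AB1.
by rewrite -[RHS](mulKmx Au) AB1 mulmx1.
Qed.

Lemma invmx_ublock (F : fieldType) (n1 n2 : nat)
    (A : 'M[F]_n1) (B : 'M[F]_(n1, n2)) (D : 'M[F]_n2) :
  A \in unitmx -> D \in unitmx ->
  invmx (block_mx A B 0 D) =
    block_mx (invmx A) (- (invmx A *m B *m invmx D)) 0 (invmx D).
Proof.
move=> Au Du; apply: invmx_eq.
rewrite mulmx_block !mulmx0 !mul0mx !addr0 add0r !mulmxV // mulmxN !mulmxA.
by rewrite mulmxV // mul1mx addNr -scalar_mx_block.
Qed.

Lemma char_poly_ublock (R : comNzRingType) (n1 n2 : nat)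
    (A : 'M[R]_n1) (B : 'M[R]_(n1, n2)) (D : 'M[R]_n2) :
  char_poly (block_mx A B 0 D) = char_poly A * char_poly D.
Proof.
rewrite /char_poly /char_poly_mx map_block_mx map_mx0 scalar_mx_block.
by rewrite opp_block_mx add_block_mx oppr0 addr0 det_ublock.
Qed.

Lemma char_poly_intertwined (F : fieldType) (n : nat) (P A B : 'M[F]_n) :
  P \in unitmx -> A *m P = P *m B -> char_poly A = char_poly B.
Proof.
move=> Pu AP; have -> : A = P *m B *m invmx P by rewrite -AP mulmxK.
pose f := map_mx (@polyC F).
have fP : f n n P *m f n n (invmx P) = 1%:M.
  by rewrite -map_mxM mulmxV // map_mx1.
rewrite /char_poly /char_poly_mx.
have -> : 'X%:M - f n n (P *m B *m invmx P) =
    f n n P *m ('X%:M - f n n B) *m f n n (invmx P).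
  rewrite mulmxBr mulmxBl -!map_mxM; congr (_ - _).
  by rewrite scalar_mxC -mulmxA fP mulmx1.
by rewrite !det_mulmx mulrAC -det_mulmx fP det1 mul1r.
Qed.

Lemma char_poly_scalar_mx (F : fieldType) (n : nat) (a : F) :
  char_poly (a%:M : 'M_n) = ('X - a%:P) ^+ n.
Proof.
by rewrite /char_poly /char_poly_mx map_scalar_mx -raddfB det_scalar.
Qed.

(** * Uniqueness for the Stein equation of a scaled isometry *)

Lemma mxtrace_gram_eq0 (F : realFieldType) (n : nat) (D : 'M[F]_n) :
  \tr (D^T *m D) = 0 -> D = 0.
Proof.
move=> trD; apply/matrixP => i j; rewrite mxE; apply/eqP.
have ge0 k l : 0 <= D k l ^+ 2 by rewrite sqr_ge0.
move: trD; rewrite /mxtrace => /eqP.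
under eq_bigr => k _ do
  (rewrite mxE; under eq_bigr => l _ do rewrite mxE -expr2).
rewrite psumr_eq0 => [/allP /(_ j (mem_index_enum _)) /=|k _]; last first.
  exact: sumr_ge0.
rewrite psumr_eq0 => [/allP /(_ i (mem_index_enum _)) /=|k _] //.
by rewrite sqrf_eq0.
Qed.

(* Conjugation by s multiplies the Frobenius norm by c > 1, so it has no
   nonzero fixed point. *)
Lemma stein_homogeneous_eq0 (F : realFieldType) (n : nat) (c : F)
    (s D : 'M[F]_n) :
  1 < c -> s *m s^T = c%:M -> s^T *m D *m s = D -> D = 0.
Proof.
move=> c1 ssT sDs; apply: mxtrace_gram_eq0; set t := \tr _.
have : t = c ^+ 2 * t.
  rewrite {1}/t -{1 2}sDs !trmx_mul trmxK !mulmxA.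
  rewrite -(mulmxA (s^T *m D^T) s s^T) ssT mul_mx_scalar -!scalemxAl mxtraceZ.
  rewrite mxtrace_mulC !mulmxA ssT mul_scalar_mx -scalemxAl mxtraceZ.
  by rewrite mulrA -expr2.
move/eqP; rewrite -subr_eq0 -{1}[t]mul1r -mulrBl mulf_eq0 subr_eq0.
by rewrite eq_sym gt_eqF ?exprn_egt1 //= => /eqP.
Qed.

(** * Shift blocks: norm, invertibility, spectrum of the inverse *)

Lemma toCM (K : realType) (m n p : nat) (A : 'M[K]_(m, n)) (B : 'M[K]_(n, p)) :
  toC (A *m B) = toC A *m toC B.
Proof. exact: map_mxM. Qed.

(** Either kind of block is |alpha| times an orthogonal matrix. Its invertibility and the symmetry
    of [x] both come from this identity. *)
Lemma shift_s_mul_tr (K : realType) (q : nat) (a : K[i]) :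
  shift_s q a *m (shift_s q a)^T = (complex.Re a ^+ 2 + complex.Im a ^+ 2)%:M.
Proof.
case: a => a b; rewrite /shift_s /shift_dim /=.
case: (b =P 0) => [->|_].
  by rewrite tr_scalar_mx -scalar_mxM mulrNN expr0n addr0 -expr2.
rewrite tr_block_mx !tr_scalar_mx mulmx_block -!scalar_mxM -!raddfD /=.
rewrite !mulrNN -!expr2 mulrN mulNr [b * a]mulrC.
by rewrite addNr scalar_mx_block !raddf0 [b ^+ 2 + _]addrC.
Qed.

Lemma Re2_Im2_gt1 (K : realType) (a : K[i]) :
  1 < `|a| -> 1 < complex.Re a ^+ 2 + complex.Im a ^+ 2.
Proof.
move=> a1; rewrite -ltcR add_Re2_Im2; exact: exprn_egt1.
Qed.

Lemma shift_s_unit (K : realType) (q : nat) (a : K[i]) :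
  1 < `|a| -> shift_s q a \in unitmx.
Proof.
move=> /Re2_Im2_gt1 c1; set c := _ + _ in c1.
have c0 : c != 0 by rewrite gt_eqF // (lt_trans ltr01).
suff /mulmx1_unit[] : shift_s q a *m (c^-1 *: (shift_s q a)^T) = 1%:M by [].
by rewrite -scalemxAr shift_s_mul_tr scale_scalar_mx mulVf.
Qed.

Definition mirrored_shift (K : realType) (q : nat) (a : K[i]) : seq K[i] :=
  nseq q (- a^-1) ++
  (if complex.Im a == 0 then [::] else nseq q (- (conjc a)^-1)).

(** Over the complex numbers the non-real block is similar, through [P], to a block triangular [U]
    with -alpha and -conj(alpha) on the diagonal. The same [P] intertwines the inverses, so the
    spectrum is read off [invmx U]. *)
Lemma char_poly_inv_shift_s (K : realType) (q : nat) (a : K[i]) :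
  1 < `|a| ->
  char_poly (toC (invmx (shift_s q a))) =
    \prod_(z <- mirrored_shift q a) ('X - z%:P).
Proof.
move=> a1; have su := shift_s_unit q a1.
have a0 : a != 0 by rewrite -normr_gt0 (lt_trans ltr01).
have prod_nseq k (z : K[i]) :
    \prod_(y <- nseq k z) ('X - y%:P) = ('X - z%:P) ^+ k.
  by rewrite big_nseq iter_mulr_1.
rewrite /toC map_invmx -/(toC _) /mirrored_shift big_cat /= prod_nseq.
move: su a0; case: a {a1} => a b; rewrite /shift_s /shift_dim /=.
case: (b =P 0) => [->|_] su a0.
  rewrite big_nil mulr1 /toC map_scalar_mx invmx_scalar char_poly_scalar_mx.
  by rewrite rmorphN /= invrN.
rewrite prod_nseq; set u := (_ +i* _)%C in a0 *; set v := conjc u.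
have v0 : v != 0 by rewrite conjc_eq0.
pose I : K[i] := ('i)%C; have II : I * I = -1 by rewrite -expr2 sqr_i.
have uE : u = a%:C%C + I * b%:C%C by rewrite {1}[u]complexE.
have vE : v = a%:C%C - I * b%:C%C by rewrite [v]complexE /= rmorphN mulrN.
(* (1, 'i) is a common eigenvector of the rotation blocks. *)
pose P : 'M[K[i]]_(q + q) := block_mx 1%:M 0 I%:M 1%:M.
pose U : 'M[K[i]]_(q + q) := block_mx (- u)%:M (- b%:C%C)%:M 0 (- v)%:M.
set s := block_mx _ _ _ _ in su *.
have Pu : P \in unitmx by rewrite unitmxE det_lblock !det1 mulr1 unitr1.
have Uu : U \in unitmx.
  by rewrite unitmx_ublock !unitmxE !det_scalar !unitrX ?unitfE ?oppr_eq0.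
have sP : toC s *m P = P *m U.
  rewrite /toC map_block_mx !map_scalar_mx !mulmx_block.
  rewrite !mul1mx !mulmx1 !mulmx0 !mul0mx !addr0 !add0r.
  rewrite -!scalar_mxM -!raddfD /=.
  rewrite !rmorphN /=.
  have -> : - a%:C%C + - b%:C%C * I = - u by rewrite uE; ring.
  have -> : b%:C%C + - a%:C%C * I = I * - u by rewrite uE; ring: II.
  have -> : I * - b%:C%C - v = - a%:C%C by rewrite vE; ring.
  by rewrite !raddfN.
have siP : invmx (toC s) *m P = P *m invmx U.
  have tsu : toC s \in unitmx by rewrite map_unitmx.
  by rewrite -[LHS](mulmxK Uu) -(mulmxA _ P) -sP mulKmx.
rewrite (char_poly_intertwined Pu siP) invmx_ublock; last 2 first.
- by rewrite unitmxE det_scalar unitrX ?unitfE ?oppr_eq0.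
- by rewrite unitmxE det_scalar unitrX ?unitfE ?oppr_eq0.
by rewrite char_poly_ublock !invmx_scalar !char_poly_scalar_mx !invrN.
Qed.

(** * Consequences of the Stein equation over an arbitrary field *)

Section ProjectedRiccati.

Variables (F : fieldType) (m q k : nat).
Variables (S X : 'M[F]_k) (L : 'M[F]_(q, k)) (B : 'M[F]_(k, m)).
Variables (R : 'M[F]_m) (Z : 'M[F]_q).
Hypotheses (S_unit : S \in unitmx) (X_unit : X \in unitmx).
Hypothesis R_unit : R \in unitmx.
Hypotheses (X_sym : X^T = X) (R_sym : R^T = R) (Z_sym : Z^T = Z).

Let Q := invmx X.
Let T := B^T *m Q *m B + R.
Let G := B *m invmx R *m B^T.
Let P := Q - Q *m B *m invmx T *m B^T *m Q.
Let C := L *m invmx S *m Q.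
(** This expression is [Ahatr] of the theorem; the Sylvester equation and [V] identify the two only
    at the end. *)
Let Ar := S^T - L^T *m Z *m C.

Hypothesis T_unit : T \in unitmx.
Hypothesis stein : S^T *m X *m S - X - L^T *m Z *m L - G = 0.

Lemma woodbury_mul : P *m (X + G) = 1%:M.
Proof.
have TR : B^T *m Q *m B = T - R by rewrite addrK.
(* With [B^T *m Q *m B = T - R], the inner factor is [invmx T *m (T - R) *m invmx R = invmx R -
   invmx T]. *)
have QBG : Q *m B *m invmx T *m B^T *m Q *m G =
    Q *m G - Q *m B *m invmx T *m B^T.
  rewrite /G !mulmxA -(mulmxA _ B^T Q) -(mulmxA _ _ B) TR mulmxBr mulmxKV //.
  by rewrite !mulmxBl -!(mulmxA _ R) mulmxV // mulmx1.
rewrite /P mulmxDr !mulmxBl mulVmx // mulmxKV // QBG.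
by rewrite subKr subrK.
Qed.

Lemma stein_gram : S^T *m X *m S - L^T *m Z *m L = X + G.
Proof.
by apply/eqP; rewrite -subr_eq0 opprD addrA [_ - _ - X]addrAC stein.
Qed.

Lemma reduced_matrixE : Ar = (X + G) *m invmx S *m Q.
Proof.
have SXL : S^T *m X - L^T *m Z *m L *m invmx S = (X + G) *m invmx S.
  by rewrite -stein_gram mulmxBl mulmxK.
by rewrite -SXL mulmxBl mulmxK // /Ar /C !mulmxA.
Qed.

(** This identity eliminates [B] and [R]: the Riccati equation, the closed loop and the mixed terms
    of the residual all reduce to it. *)
Lemma woodbury_reduced_matrix : P *m Ar = invmx S *m Q.
Proof. by rewrite reduced_matrixE !mulmxA woodbury_mul mul1mx. Qed.

Lemma invX_sym : Q^T = Q. Proof. by rewrite trmx_inv X_sym. Qed.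

Lemma schur_complement_sym : T^T = T.
Proof. by rewrite raddfD /= !trmx_mul trmxK invX_sym R_sym mulmxA. Qed.

Lemma woodbury_sym : P^T = P.
Proof.
rewrite raddfB /= !trmx_mul trmxK invX_sym trmx_inv schur_complement_sym.
by rewrite !mulmxA.
Qed.

Lemma mul_woodburyE (a b : nat) (U : 'M[F]_(a, k)) (V : 'M[F]_(k, b)) :
  U *m P *m V = U *m Q *m V - U *m Q *m B *m invmx T *m B^T *m Q *m V.
Proof. by rewrite mulmxBr mulmxBl !mulmxA. Qed.

(** The first three terms are [Ar^T *m P *m Ar - Q], and [(S - C^T *m Z *m L) *m invmx S *m Q = Q -
    C^T *m Z *m C]. *)
Lemma riccati :
  Ar^T *m Q *m Ar - Q
  - Ar^T *m Q *m B *m invmx T *m B^T *m Q *m Ar + C^T *m Z *m C = 0.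
Proof.
have -> : Ar^T *m Q *m Ar - Q - Ar^T *m Q *m B *m invmx T *m B^T *m Q *m Ar =
    Ar^T *m P *m Ar - Q.
  by rewrite mul_woodburyE addrAC.
have ArT : Ar^T = S - C^T *m Z *m L.
  by rewrite raddfB /= !trmx_mul !trmxK Z_sym mulmxA.
rewrite -mulmxA woodbury_reduced_matrix ArT mulmxBl mulKVmx //.
by rewrite -(mulmxA _ L) [L *m _]mulmxA -/C addrAC subrK subrr.
Qed.

(** Since [X *m P = 1 - B *m invmx T *m B^T *m Q], the left side is [X *m P *m Ar]. *)
Lemma closed_loopE :
  Ar - B *m invmx T *m B^T *m Q *m Ar = X *m invmx S *m Q.
Proof.
have -> : Ar - B *m invmx T *m B^T *m Q *m Ar = X *m (P *m Ar).
  by rewrite mulmxA mul_woodburyE mulmxV // !mul1mx.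
by rewrite woodbury_reduced_matrix mulmxA.
Qed.

(** [N] and [P] are the inverses of [S^T *m X *m S] and [X + G], which differ by [L^T *m Z *m L].
    The resolvent identity [N *m (L^T *m Z *m L) *m P = P - N] makes the product collapse. *)
Lemma mul_M_inverse :
  (1%:M - C *m X *m C^T *m Z) *m (1%:M + L *m P *m L^T *m Z) = 1%:M.
Proof.
pose N := invmx S *m Q *m (invmx S)^T.
have CXC : C *m X *m C^T = L *m N *m L^T.
  by rewrite /C mulmxKV // !trmx_mul invX_sym !mulmxA.
have NP : N *m (L^T *m Z *m L) *m P = P - N.
  have -> : L^T *m Z *m L = S^T *m X *m S - (X + G).
    by rewrite -stein_gram subKr.
  rewrite [N *m _]mulmxBr mulmxBl -(mulmxA N (X + G)) (mulmx1C woodbury_mul).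
  rewrite mulmx1; congr (_ - _).
  rewrite /N !mulmxA -(mulmxA _ _ S^T) -trmx_mul mulmxV // trmx1 mulmx1.
  by rewrite mulmxKV // mulVmx // mul1mx.
rewrite CXC mulmxDr mulmx1 mulmxBl mul1mx.
have -> : L *m N *m L^T *m Z *m (L *m P *m L^T *m Z) =
    L *m (N *m (L^T *m Z *m L) *m P) *m L^T *m Z by rewrite !mulmxA.
by rewrite NP [L *m (_ - N)]mulmxBr 2!mulmxBl subKr subrK.
Qed.

(** Here [A], [Y], [D] stand for W^T Ahat, W^T E, C_perp. Terms quadratic in [Y] cancel by the
    Riccati equation, mixed ones because [L *m P *m Ar = C]. *)
Lemma residual_factor (n : nat) (A Y : 'M[F]_(k, n)) (D : 'M[F]_(q, n)) :
  A = Ar *m Y - L^T *m Z *m D ->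
  A^T *m P *m A - Y^T *m Q *m Y + (D + C *m Y)^T *m Z *m (D + C *m Y) =
    D^T *m (Z + Z *m L *m P *m L^T *m Z) *m D.
Proof.
set J := invmx S => AE.
have CT : C^T = Q *m J^T *m L^T by rewrite /C !trmx_mul invX_sym mulmxA.
have ArP : Ar^T *m P = Q *m J^T.
  rewrite -[P]woodbury_sym -trmx_mul woodbury_reduced_matrix trmx_mul.
  by rewrite invX_sym.
have ArPAr : Ar^T *m P *m Ar = Q - C^T *m Z *m C.
  apply/eqP; rewrite -subr_eq0 opprB addrA mul_woodburyE addrAC.
  by rewrite [X in X + _]addrAC riccati.
have yy : (Ar *m Y)^T *m P *m (Ar *m Y) =
    Y^T *m Q *m Y - Y^T *m C^T *m Z *m C *m Y.
  rewrite trmx_mul.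
  have -> : Y^T *m Ar^T *m P *m (Ar *m Y) = Y^T *m (Ar^T *m P *m Ar) *m Y.
    by rewrite !mulmxA.
  by rewrite ArPAr mulmxBr mulmxBl !mulmxA.
have yd : (Ar *m Y)^T *m P *m (L^T *m Z *m D) = Y^T *m C^T *m Z *m D.
  by rewrite trmx_mul -(mulmxA Y^T Ar^T) ArP CT !mulmxA.
have dy : (L^T *m Z *m D)^T *m P *m (Ar *m Y) = D^T *m Z *m C *m Y.
  rewrite -[LHS]mulmxA [P *m _]mulmxA woodbury_reduced_matrix !trmx_mul trmxK.
  by rewrite Z_sym !mulmxA.
have dd : (L^T *m Z *m D)^T *m P *m (L^T *m Z *m D) =
    D^T *m (Z *m L *m P *m L^T *m Z) *m D.
  by rewrite !trmx_mul trmxK Z_sym !mulmxA.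
rewrite AE [(_ - _)^T]raddfB /= 2!mulmxBl 2![_ *m (Ar *m Y - _)]mulmxBr.
rewrite yy yd dy dd.
rewrite [(_ + _)^T]raddfD /= [(C *m Y)^T]trmx_mul 2!mulmxDl.
rewrite 2![_ *m (D + _)]mulmxDr !(mulmxA _ C Y) [D^T *m (Z + _)]mulmxDr mulmxDl.
rewrite opprB !addrA -!addrA addrC !addrA.
(* Of ten summands, four pairs of opposites vanish; two quadratic in [D] remain. *)
by rewrite [LHS](ACl (6*3*(1*9)*(2*8)*(4*7)*(5*10))) /= !addNr !addr0.
Qed.

(** * Lifting to the full-order residual *)

Section FullOrder.

Variables (n : nat) (E Ah : 'M[F]_n) (Bf : 'M[F]_(n, m)) (Cf : 'M[F]_(q, n)).
Variable W : 'M[F]_(n, k).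
Hypothesis B_def : B = W^T *m Bf.
Hypothesis sylvester : Ah^T *m W - E^T *m W *m S + Cf^T *m Z *m L = 0.

Let D := Cf - C *m W^T *m E.

(** Replacing [S] by [Ar^T] and [Cf] by [D] adds and subtracts the same matrix
    [E^T *m W *m C^T *m Z *m L]. *)
Lemma sylvester_reduced : Ah^T *m W - E^T *m W *m Ar^T + D^T *m Z *m L = 0.
Proof.
have ArT : Ar^T = S - C^T *m Z *m L.
  by rewrite [LHS]raddfB /= !trmx_mul !trmxK Z_sym mulmxA.
have DT : D^T = Cf^T - E^T *m W *m C^T.
  rewrite [LHS]raddfB /= [(C *m _ *m _)^T]trmx_mul [(C *m _)^T]trmx_mul.
  by rewrite trmxK mulmxA.
rewrite ArT DT -[RHS]sylvester mulmxBr !(mulmxBl Cf^T) mulmxBl !mulmxA.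
by rewrite opprB !addrA [LHS](ACl (1*3*4*(2*5))) /= subrr addr0.
Qed.

(** [Qf] factors through [W], so [Ah] and [E] enter the terms in [Qf] only as [W^T *m Ah] and
    [W^T *m E]; transposing [sylvester_reduced] relates these two as [residual_factor] requires. *)
Lemma residualE (Qf : 'M[F]_n) :
  Qf = W *m Q *m W^T ->
  Ah^T *m Qf *m Ah - E^T *m Qf *m E
  - Ah^T *m Qf *m Bf *m invmx (Bf^T *m Qf *m Bf + R) *m Bf^T *m Qf *m Ah
  + Cf^T *m Z *m Cf =
  D^T *m (Z + Z *m L *m P *m L^T *m Z) *m D.
Proof.
move=> ->.
have TE : Bf^T *m (W *m Q *m W^T) *m Bf + R = T.
  by rewrite /T B_def trmx_mul trmxK !mulmxA.
have AWE : W^T *m Ah = Ar *m (W^T *m E) - L^T *m Z *m D.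
  apply: trmx_inj; rewrite [RHS]raddfB /= [(Ar *m _)^T]trmx_mul.
  rewrite ![(W^T *m _)^T]trmx_mul trmxK [(_ *m D)^T]trmx_mul.
  rewrite [(L^T *m Z)^T]trmx_mul trmxK Z_sym mulmxA.
  apply/eqP; rewrite -subr_eq0 opprB addrA addrAC; apply/eqP.
  exact: sylvester_reduced.
have CfE : D + C *m (W^T *m E) = Cf by rewrite /D !mulmxA subrK.
rewrite -(residual_factor AWE) CfE TE mul_woodburyE [X in X + _ = _]addrAC.
have UT (U : 'M[F]_n) : (W^T *m U)^T = U^T *m W by rewrite trmx_mul trmxK.
have BT : B^T = Bf^T *m W by rewrite B_def trmx_mul trmxK.
by rewrite !UT BT [in RHS]B_def !mulmxA.
Qed.

End FullOrder.

End ProjectedRiccati.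

(** * The recursion, accumulated step by step *)

Section RecursionTheory.

Variables (K : realType) (n m q : nat).
Variables (E : 'M[K]_n) (B : 'M[K]_(n, m)) (R : 'M[K]_m).
Variables (Chat : 'M[K]_(q, n)) (Zhat : 'M[K]_q) (Ahat : 'M[K]_n).
Variable alpha : nat -> K[i].
Variable w : forall j : nat, 'M[K]_(n, shift_dim q (alpha j)).
Variable x : forall j : nat, 'M[K]_(shift_dim q (alpha j)).
Variable i : nat.
Hypotheses (R_sym : R^T = R) (Zhat_sym : Zhat^T = Zhat).
Hypothesis alpha_gt1 : forall j : nat, (1 <= j <= i)%N -> 1 < `|alpha j|.
Hypothesis w_step : forall j, (1 <= j <= i)%N ->
  w_eq E B R Chat Zhat w x Ahat j.
Hypothesis x_step : forall j, (1 <= j <= i)%N -> x_eq B R Zhat w x j.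
Hypothesis X_unit : acc_X x i \in unitmx.

Local Notation L := (acc_L q alpha).
Local Notation W := (acc_W w).
Local Notation X := (acc_X x).
Local Notation S := (acc_S B R Zhat w x).
Local Notation S12 := (step_S12 B R Zhat w x).
Local Notation C := (acc_C B R Zhat w x).
Local Notation c := (step_c B R Zhat w x).
Local Notation Cperp := (acc_Cperp E B R Chat Zhat w x).

(** [X j] is a leading diagonal block of [X i], so invertibility descends from the last step; hence
    the induction on [i - j]. *)
Lemma acc_X_unit j : (j <= i)%N -> X j \in unitmx.
Proof.
move=> ji; move: X_unit; rewrite -(subnK ji); elim: (i - j)%N => //= d IH.
by rewrite unitmx_ublock => /andP[/IH].
Qed.

Lemma step_s_unit j : (j < i)%N -> shift_s q (alpha j.+1) \in unitmx.
Proof. by move=> ji; apply/shift_s_unit/alpha_gt1. Qed.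

Lemma unitmx0 (A : 'M[K]_0) : A \in unitmx.
Proof. by rewrite unitmxE det_mx00 unitr1. Qed.

Lemma acc_S_unit j : (j <= i)%N -> S j \in unitmx.
Proof.
elim: j => [_|j IH ji]; first exact: unitmx0.
by rewrite /= unitmx_ublock (IH (ltnW ji)) step_s_unit.
Qed.

Lemma ctrl_sym (k : nat) (U : 'M[K]_(n, k)) :
  (U^T *m B *m invmx R *m B^T *m U)^T = U^T *m B *m invmx R *m B^T *m U.
Proof. by rewrite !trmx_mul !trmxK trmx_inv R_sym !mulmxA. Qed.

(** [x_eq] reads [s^T *m x *m s = x + H] with [H] symmetric, so the transpose of [x] solves it
    too. *)
Lemma step_x_sym j : (j < i)%N -> (X j)^T = X j -> (x j.+1)^T = x j.+1.
Proof.
move=> ji Xj; have := x_step (j := j.+1) ji; rewrite /x_eq /=.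
set s := shift_s _ _; set l := shift_l _ _; move: (step_S12 _ _ _ _ _ _) => S'.
pose H := l^T *m Zhat *m l + (w j.+1)^T *m B *m invmx R *m B^T *m w j.+1
          - S'^T *m X j *m S'.
have HT : H^T = H.
  rewrite raddfB raddfD /= ctrl_sym !trmx_mul !trmxK Zhat_sym Xj.
  by rewrite /H !mulmxA.
move=> xE; have {}xE : s^T *m x j.+1 *m s = x j.+1 + H.
  apply/eqP; rewrite -subr_eq0 -xE /H; apply/eqP.
  by rewrite !opprD opprK !addrA.
apply/esym/eqP; rewrite -subr_eq0; apply/eqP.
apply: (stein_homogeneous_eq0 (s := s)).
- exact: Re2_Im2_gt1 (alpha_gt1 (j := j.+1) ji).
- exact: shift_s_mul_tr.
have -> : s^T *m (x j.+1 - (x j.+1)^T) *m s = x j.+1 + H - (x j.+1 + H)^T.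
  by rewrite mulmxBr mulmxBl -xE !trmx_mul trmxK mulmxA.
by rewrite raddfD /= HT opprD addrACA subrr addr0.
Qed.

Lemma acc_X_sym j : (j <= i)%N -> (X j)^T = X j.
Proof.
elim: j => [_|j IH ji]; first by rewrite /= trmx0.
have Xj := IH (ltnW ji).
by rewrite /= tr_block_mx !trmx0 Xj step_x_sym.
Qed.

Lemma step_S12_eq j : (j < i)%N ->
  (S j)^T *m X j *m S12 j.+1 =
    (L j)^T *m Zhat *m shift_l q (alpha j.+1)
    + (W j)^T *m B *m invmx R *m B^T *m w j.+1.
Proof.
move=> ji; rewrite /step_S12 /S12_from /= !mulmxA mulmxK ?acc_X_unit 1?ltnW //.
by rewrite -trmx_mul mulVmx ?trmx1 ?mul1mx // acc_S_unit 1?ltnW.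
Qed.

Lemma acc_S_succ j :
  S j.+1 = block_mx (S j) (S12 j.+1) 0 (shift_s q (alpha j.+1)).
Proof. by []. Qed.

(** Upper left is the induction hypothesis, lower right is [x_eq]; the off-diagonal blocks are
    [step_S12_eq] and, as [X j] is symmetric, its transpose. *)
Lemma acc_stein j : (j <= i)%N ->
  (S j)^T *m X j *m S j - X j - (L j)^T *m Zhat *m L j
  - (W j)^T *m B *m invmx R *m B^T *m W j = 0.
Proof.
elim: j => [_|j IH ji]; first by rewrite [LHS]flatmx0 [RHS]flatmx0.
have := step_S12_eq ji; have Xj := acc_X_sym (ltnW ji).
have := x_step (j := j.+1) ji; rewrite acc_S_succ /x_eq /=.
move: (step_S12 _ _ _ _ _ _) => U xE SU.
have UTS : U^T *m X j *m S j =
    (shift_l q (alpha j.+1))^T *m Zhat *m L j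
    + (w j.+1)^T *m B *m invmx R *m B^T *m W j.
  apply: trmx_inj; rewrite !trmx_mul trmxK Xj mulmxA SU.
  by rewrite raddfD /= !trmx_mul !trmxK trmx_inv Zhat_sym R_sym !mulmxA.
rewrite tr_block_mx trmx0 !tr_row_mx !mulmx_block !mul_col_mx !mul_mx_row.
rewrite -!block_mxEv.
rewrite !mul0mx !mulmx0 !addr0 !add0r.
rewrite !opp_block_mx !add_block_mx UTS SU !subr0 mul0mx addr0 (IH (ltnW ji)).
have addBB (V : zmodType) (a b : V) : a + b - a - b = 0.
  by rewrite addrAC addrK subrr.
rewrite !addBB (_ : _ + _ - _ - _ - _ = 0) ?block_mx0 //.
by rewrite -[RHS]xE -!addrA addrC !addrA.
Qed.

(** In the new columns [E^T *m W j *m S12 j.+1] has two parts: the feedback correction in [w_eq],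
    and the correction that turns [Chat] into [Cperp]. *)
Lemma acc_sylvester j : (j <= i)%N ->
  Ahat^T *m W j - E^T *m W j *m S j + Chat^T *m Zhat *m L j = 0.
Proof.
elim: j => [_|j IH ji]; first by rewrite [LHS]thinmx0 [RHS]thinmx0.
rewrite acc_S_succ /= !mul_mx_row mul_row_block mulmx0 addr0.
rewrite opp_row_mx !add_row_mx (IH (ltnW ji)).
have ji' := ltnW ji.
have CpT : (Cperp j)^T =
    Chat^T - E^T *m W j *m invmx (X j) *m (invmx (S j))^T *m (L j)^T.
  rewrite /acc_Cperp /acc_C raddfB /= !trmx_mul trmxK trmx_inv acc_X_sym //.
  by rewrite !mulmxA.
have W12 : W j *m S12 j.+1 =
    W j *m invmx (X j) *m (invmx (S j))^T *m (L j)^T *m Zhat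
      *m shift_l q (alpha j.+1)
    + W j *m invmx (X j) *m (invmx (S j))^T *m (W j)^T *m B *m invmx R
      *m B^T *m w j.+1.
  by rewrite /step_S12 /S12_from /= !mulmxA mulmxDr !mulmxA.
rewrite (_ : _ + _ = 0) ?row_mx0 //.
rewrite -[RHS](w_step (j := j.+1) ji) /w_eq /= CpT !mulmxBl.
rewrite -(mulmxA E^T (W j) (S12 j.+1)) W12 mulmxDr !mulmxA.
by rewrite !opprD !addrA [LHS](ACl (1*3*4*5*2)).
Qed.

(** [S] is block triangular and [X] block diagonal, so a further step leaves the old columns of [C]
    unchanged. *)
Lemma acc_C_succ j : (j < i)%N -> C j.+1 = row_mx (C j) (c j.+1).
Proof.
move=> ji; have Su := acc_S_unit (ltnW ji); have su := step_s_unit ji.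
rewrite /acc_C acc_S_succ /= invmx_ublock // invmx_block_diag; last first.
  exact: (acc_X_unit ji).
rewrite !mul_row_block !mulmx0 !addr0 add0r /step_c /=; congr row_mx.
by rewrite mulmxN [- _ + _]addrC !mulmxBl !mulmxA.
Qed.

Lemma row_of_steps_cE j : (j <= i)%N -> row_of_steps_c B R Zhat w x j = C j.
Proof.
elim: j => [_|j IH ji]; first by rewrite [LHS]thinmx0 [RHS]thinmx0.
by rewrite acc_C_succ //= IH 1?ltnW.
Qed.

Lemma acc_M_succ j : (j < i)%N ->
  acc_M B R Zhat w x j.+1 =
    acc_M B R Zhat w x j - c j.+1 *m x j.+1 *m (c j.+1)^T *m Zhat.
Proof.
move=> ji; rewrite /acc_M acc_C_succ //=; move: (C j) (c j.+1) => U v.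
rewrite tr_row_mx mul_row_block !mulmx0 addr0 add0r mul_row_col mulmxDl.
by rewrite opprD addrA.
Qed.

Lemma char_poly_inv_acc_S j : (j <= i)%N ->
  char_poly (toC (invmx (S j))) =
    \prod_(z <- mirrored_shifts q alpha j) ('X - z%:P).
Proof.
elim: j => [_|j IH ji].
  by rewrite /char_poly det_mx00 /mirrored_shifts /= big_nil.
have Su := acc_S_unit (ltnW ji); have su := step_s_unit ji.
rewrite acc_S_succ invmx_ublock // /toC map_block_mx map_mx0 char_poly_ublock.
rewrite -!/(toC _) IH 1?ltnW // char_poly_inv_shift_s ?alpha_gt1 //.
(* The new block sits at the lower right of [S], so its shift is the last index of the range. *)
have iotaS : iota 1 j.+1 = rcons (iota 1 j) j.+1.
  by rewrite -{1}[j.+1]addn1 iotaD cats1 add1n.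
by rewrite /mirrored_shifts iotaS map_rcons flatten_rcons !big_cat.
Qed.

Lemma mirrored_shifts_lt1 (z : K[i]) :
  z \in mirrored_shifts q alpha i -> `|z| < 1.
Proof.
case/flatten_mapP => j; rewrite mem_iota add1n ltnS => /alpha_gt1 aj.
have inv_lt1 (a : K[i]) : 1 < `|a| -> `|- a^-1| < 1.
  by move=> a1; rewrite normrN normfV invf_lt1 // (lt_trans ltr01).
rewrite mem_cat => /orP[|]; first by move=> /nseqP[-> _]; exact: inv_lt1.
by case: ifP => // _ /nseqP[-> _]; apply: inv_lt1; rewrite normcJ.
Qed.

End RecursionTheory.

(** * Spectrum from a factored characteristic polynomial, and assembly of the three claims *)

Lemma has_spectrum_char_poly (K : realType) (k : nat) (M : 'M[K]_k)
    (s : seq K[i]) :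
  char_poly (toC M) = \prod_(z <- s) ('X - z%:P) -> has_spectrum M s.
Proof.
move=> cM; split=> z; last by rewrite cM mu_prod_XsubC.
by rewrite eigenvalue_root_char cM root_prod_XsubC.
Qed.

Theorem theorem2p1 (K : realType) (n m p : nat)
  (n_gt0 : (0 < n)%N) (m_gt0 : (0 < m)%N) (p_gt0 : (0 < p)%N)
  (E A : 'M[K]_n) (B : 'M[K]_(n, m))
  (C1 : 'M[K]_(p, n)) (C2 : 'M[K]_(m, n))
  (R : 'M[K]_m) (Z : 'M[K]_p)
  (R_sym : R^T = R) (Z_sym : Z^T = Z)
  (E_unit : E \in unitmx) (R_unit : R \in unitmx)
  (i : nat) (i_gt0 : (0 < i)%N)
  (alpha : nat -> K[i])
  (alpha_gt1 : forall j : nat, (1 <= j <= i)%N -> 1 < `|alpha j|)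
  (w : forall j : nat, 'M[K]_(n, shift_dim (p + m) (alpha j)))
  (x : forall j : nat, 'M[K]_(shift_dim (p + m) (alpha j))) :
  let Ahat := A - B *m invmx R *m C2 in
  let Chat := col_mx C1 C2 in
  let Zhat := block_mx Z 0 0 (- invmx R) in
  let L := acc_L (p + m) alpha in
  let W := acc_W w in
  let X := acc_X x in
  let S := acc_S B R Zhat w x in
  let Cperp := acc_Cperp E B R Chat Zhat w x in
  let c := step_c B R Zhat w x in
  let M := acc_M B R Zhat w x in
  (forall j : nat, (1 <= j <= i)%N -> w_eq E B R Chat Zhat w x Ahat j) ->
  (forall j : nat, (1 <= j <= i)%N -> x_eq B R Zhat w x j) ->
  observable (S i) (Zhat *m L i) ->
  X i \in unitmx ->
  let Br := (W i)^T *m B in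
  R + Br^T *m invmx (X i) *m Br \in unitmx ->
  forall V : 'M[K]_(n, acc_dim (p + m) alpha i),
  (W i)^T *m E *m V = 1%:M ->
  let Cr := Chat *m V in
  let C2r := dsubmx Cr in
  let Ar := (W i)^T *m A *m V in
  let Ahatr := (W i)^T *m Ahat *m V in
  Cr = L i *m invmx (S i) *m invmx (X i) ->
  let Q := invmx (X i) in
  let Acl := Ar - Br *m invmx (Br^T *m Q *m Br + R) *m (Br^T *m Q *m Ar + C2r) in
  let Qhat := W i *m Q *m (W i)^T in
  let Rq := Ahat^T *m Qhat *m Ahat - E^T *m Qhat *m E
            - Ahat^T *m Qhat *m B *m invmx (B^T *m Qhat *m B + R)
              *m B^T *m Qhat *m Ahat
            + Chat^T *m Zhat *m Chat in

  [/\ Ahat^T *m W i - E^T *m W i *m S i + Chat^T *m Zhat *m L i = 0,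
      Ahatr = Ar - Br *m invmx R *m C2r,
      Ahatr = (S i)^T - (L i)^T *m Zhat *m Cr &
      Cr = row_of_steps_c B R Zhat w x i]

  /\ [/\ Ahatr^T *m Q *m Ahatr - Q
           - Ahatr^T *m Q *m Br *m invmx (Br^T *m Q *m Br + R)
             *m Br^T *m Q *m Ahatr
           + Cr^T *m Zhat *m Cr = 0,
         schur_stable Acl &
         has_spectrum Acl (mirrored_shifts (p + m) alpha i)]

  /\ [/\ V^T *m Rq *m V = 0,
         M i = 1%:M - Cr *m X i *m Cr^T *m Zhat,
         M i \in unitmx,
         Rq = (Cperp i)^T *m Zhat *m invmx (M i) *m Cperp i &
         M 0%N = 1%:M /\
         forall j : nat, (1 <= j <= i)%N ->
           M j = M j.-1 - c j *m x j *m (c j)^T *m Zhat]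

  /\ Ahat^T *m W i - E^T *m W i *m Ahatr^T + (Cperp i)^T *m Zhat *m L i = 0.
Proof.
move=> Ahat Chat Zhat L W X S Cperp c M w_step x_step _ X_unit Br T_unit V WEV.
move=> Cr C2r Ar Ahatr CrE Q Acl Qhat Rq.
have Zhat_sym : Zhat^T = Zhat.
  by rewrite tr_block_mx !trmx0 Z_sym linearN /= trmx_inv R_sym.
have S_unit : S i \in unitmx.
  exact: (acc_S_unit _ _ _ _ _ alpha_gt1 (leqnn i)).
have X_sym : (X i)^T = X i.
  exact: (acc_X_sym R_sym Zhat_sym alpha_gt1 x_step (leqnn i)).
have syl : Ahat^T *m W i - E^T *m W i *m S i + Chat^T *m Zhat *m L i = 0.
  exact: (acc_sylvester R_sym Zhat_sym alpha_gt1 w_step x_step (leqnn i)).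
have stein : (S i)^T *m X i *m S i - X i - (L i)^T *m Zhat *m L i
             - Br *m invmx R *m Br^T = 0.
  rewrite trmx_mul trmxK !mulmxA.
  exact: (acc_stein R_sym Zhat_sym alpha_gt1 x_step X_unit (leqnn i)).
have cE : acc_C B R Zhat w x i = L i *m invmx (S i) *m invmx (X i) by [].
have ME : M i = 1%:M - Cr *m X i *m Cr^T *m Zhat by rewrite CrE.
have CpE : Cperp i = Chat - Cr *m (W i)^T *m E by rewrite CrE.
have specX : char_poly (toC (invmx (S i))) =
    \prod_(z <- mirrored_shifts (p + m) alpha i) ('X - z%:P).
  exact: (char_poly_inv_acc_S _ _ _ _ _ alpha_gt1 (leqnn i)).
have lt1 := mirrored_shifts_lt1 (q := (p + m)%N) alpha_gt1.
have AhatrE : Ahatr = Ar - Br *m invmx R *m C2r.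
  rewrite /Ahatr /Ahat mulmxBr mulmxBl /C2r /Cr /Chat mul_col_mx col_mxKd.
  by rewrite /Br !mulmxA.
(* The transposed Sylvester equation is multiplied by [V], and [W^T *m E *m V = 1] absorbs [E] and
   [V]. *)
have AhatrS : Ahatr = (S i)^T - (L i)^T *m Zhat *m Cr.
  rewrite /Ahatr -[(W i)^T *m Ahat]trmxK trmx_mul trmxK.
  have -> : Ahat^T *m W i = E^T *m W i *m S i - Chat^T *m Zhat *m L i.
    by apply/eqP; rewrite -subr_eq0 opprB addrA addrAC syl.
  rewrite raddfB /= !trmx_mul !trmxK Zhat_sym mulmxBl -!mulmxA.
  by rewrite [(W i)^T *m _]mulmxA WEV mulmx1.
have cSteps : Cr = row_of_steps_c B R Zhat w x i.
  by rewrite CrE -cE (row_of_steps_cE _ _ _ _ alpha_gt1 X_unit (leqnn i)).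
have T_unit' : Br^T *m Q *m Br + R \in unitmx by rewrite addrC.
(* [Acl] is written with [Ar], [closed_loopE] with [Ahatr]. Passing to [Ahatr], the bracket gains
   [T *m invmx R *m C2r], and [Br *m invmx T] times this cancels the difference [Ar - Ahatr]. *)
have AclE : Acl = X i *m invmx (S i) *m Q.
  rewrite -(closed_loopE S_unit X_unit R_unit T_unit' stein) -CrE -AhatrS.
  set T := _ + R in T_unit' *.
  have ArE : Ar = Ahatr + Br *m invmx R *m C2r by rewrite AhatrE subrK.
  have TC : Br^T *m Q *m (Br *m invmx R *m C2r) + C2r = T *m invmx R *m C2r.
    by rewrite /T !mulmxDl mulmxV // mul1mx !mulmxA.
  have inner : Br^T *m Q *m Ar + C2r = Br^T *m Q *m Ahatr + T *m invmx R *m C2r.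
    by rewrite ArE mulmxDr -addrA TC.
  rewrite /Acl -/T inner ArE mulmxDr !mulmxA mulmxKV //.
  by rewrite opprD addrA addrAC addrK.
have spec : char_poly (toC Acl) =
    \prod_(z <- mirrored_shifts (p + m) alpha i) ('X - z%:P).
  rewrite -specX; apply: (char_poly_intertwined (P := toC (X i))).
    by rewrite map_unitmx.
  by rewrite -!toCM AclE mulmxKV.
have Minv := mul_M_inverse S_unit X_unit R_unit X_sym T_unit' stein.
rewrite -CrE -ME in Minv; have [M_unit _] := mulmx1_unit Minv.
have RqE := residualE S_unit X_unit R_unit X_sym R_sym Zhat_sym T_unit' stein
  (erefl Br) syl (erefl Qhat).
(* The inverse of [M i] is explicit in [Minv], so the middle factor of [RqE] is
   [Zhat *m invmx (M i)]. *)
have RqM : Rq = (Cperp i)^T *m Zhat *m invmx (M i) *m Cperp i.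
  rewrite [LHS]RqE (invmx_eq Minv) -CrE -CpE -/Q.
  move: (Q - _) (Cperp i) (L i) => P D l.
  by rewrite -(mulmxA _ Zhat) [Zhat *m (_ + _)]mulmxDr mulmx1 !mulmxA.
split; [|split; [|split]].
- by split.
- split; last exact: has_spectrum_char_poly.
    have := riccati S_unit X_unit R_unit Zhat_sym T_unit' stein.
    by rewrite -CrE -AhatrS.
  move=> z; rewrite eigenvalue_root_char spec root_prod_XsubC; exact: lt1.
- split=> //.
    (* Both [Chat *m V] and [Cr *m (W i)^T *m E *m V] equal [Cr], so the right factor of the
       residual vanishes on [V]. *)
    have CpV : Cperp i *m V = 0.
      by rewrite CpE mulmxBl -!mulmxA (mulmxA _ E V) WEV mulmx1 subrr.
    by rewrite RqM -!mulmxA CpV !mulmx0.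
  split=> [|[|j] //= ji]; first by rewrite /M /acc_M mulmx0 !mul0mx subr0.
  exact: (acc_M_succ _ _ _ _ alpha_gt1 X_unit ji).
- have := sylvester_reduced (X i) Zhat_sym syl.
  by rewrite -CrE -AhatrS -CpE.
Qed.
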